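(* Let $\rho>0$. Define $R_0^*=1$, $\beta_0^*=0$ and, for $n\ge 1$, $\beta_n^*=B_\rho(R_{n-1}^* )$ and $R_n^*=V_\rho(R_{n-1}^* )$. Then: (i) for every $n\ge 1$, $\beta_n^*=\min\{1,\tfrac{1}{2\rho}(1+(\rho\beta_{n-1}^* )^2)\}$; (ii) for every $n\ge1$, $\displaystyle R_n^*=\min_{(\beta_1,\dots,\beta_n)\in[0,1]^n}R_n(\beta_1,\dots,\beta_n)$ and this minimum is attained at $(\beta_1^*,\dots,\beta_n^* )$ (that is, the minimax-optimal Halpern iteration for the class $\mathrm{Lip}(\rho)$ is achieved with the parameters $\beta_n^*$); (iii) the sequence $(R_n^* )_{n\in\mathbb N}$ is strictly decreasing and converges to $r_\rho=\max\{0,1-1/\rho\}\in[0,1)$.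
   Context: For $\rho>0$, $\mathrm{Lip}(\rho)$ is the class of $\rho$-Lipschitz self-maps $T:C\to C$ of nonempty convex subsets $C$ of arbitrary normed spaces. Halpern's iteration is $x^n=(1-\beta_n)x^0+\beta_nTx^{n-1}$, $n\ge1$. For a sequence $(\beta_n)_{n\ge1}\subseteq[0,1]$, with $\beta_0=0$, $d_0=0$, $c_0=0$, $R_0=1$, define for $n\ge1$ $$d_n=|\beta_{n-1}-\beta_n|+\min\{\beta_{n-1},\beta_n\}\,c_{n-1},\quad c_n=\min\{1,\rho\,d_n\},\quad R_n=1-\beta_n(1-c_n),$$ and write $R_n=R_n(\beta_1,\dots,\beta_n)$. The numbers $\kappa R_n$ are tight upper bounds for the residuals $\|x^n-Tx^n\|$ of Halpern iterates over $T\in\mathrm{Lip}(\rho)$ with $\|Tx^m-Tx^n\|\le\kappa$ for all $m,n\ge -1$ ($Tx^{-1}=x^0$); ''minimax-optimal'' means minimizing $R_n(\beta_1,\dots,\beta_n)$ over $[0,1]^n$ for each $n\ge1$. For $r\in[0,1]$, $V_\rho(r)=\min_{\beta\in[0,1]}1-\beta+\rho\beta^2+\rho\beta(r-1)$, whose minimizer over $[0,1]$ is $B_\rho(r)=\min\{1,\tfrac12(1/\rho+1-r)\}$. *)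

(* Defs.v *)
From HB Require Import structures.
From mathcomp Require Import all_boot all_order all_algebra.
From mathcomp Require Import ring lra.
From mathcomp Require Import all_classical all_reals all_analysis.

Set Implicit Arguments.
Unset Strict Implicit.
Unset Printing Implicit Defensive.

Import Order.TTheory GRing.Theory Num.Theory.
Import numFieldNormedType.Exports.

Local Open Scope classical_set_scope.
Local Open Scope ring_scope.

Section HalpernResiduals.
Context {R : realType}.
Implicit Types (rho r b : R) (beta : nat -> R) (n : nat).

Fixpoint halpern_d rho beta n : R :=
  if n is m.+1 then
    `|beta m - beta m.+1|
      + Num.min (beta m) (beta m.+1) * Num.min 1 (rho * halpern_d rho beta m)
  else 0.

(* The convention c_0 = 0 needs no separate clause, because d_0 = 0. *)
Definition halpern_c rho beta n : R := Num.min 1 (rho * halpern_d rho beta n).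

(* These definitions are meant for sequences with beta 0 = 0, in which case the
   value at 0 is R_0 = 1. *)
Definition halpern_R rho beta n : R :=
  1 - beta n * (1 - halpern_c rho beta n).

(* A tuple (beta_1, ..., beta_n) is stored with indices shifted by one;
   prepending 0 restores the numbering and enforces beta_0 = 0. The padding of
   nth beyond index n is never read by halpern_R _ _ n. *)
Definition halpern_Rn rho n (b : n.-tuple R) : R :=
  halpern_R rho (nth 0 (0 :: b)) n.

Definition unit_cube n : set (n.-tuple R) :=
  [set b | forall i : 'I_n, tnth b i \in `[0, 1]].

Definition V_objective rho r b : R :=
  1 - b + rho * b ^+ 2 + rho * b * (r - 1).

(* For rho > 0 and r in [0, 1] this infimum is a minimum, attained at
   halpern_B rho r: see halpern_V_min below. *)
Definition halpern_V rho r : R := inf [set V_objective rho r b | b in `[0, 1]].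

Definition halpern_B rho r : R := Num.min 1 (2^-1 * (rho^-1 + 1 - r)).

Fixpoint Rstar rho n : R :=
  if n is m.+1 then halpern_V rho (Rstar rho m) else 1.

Definition beta_star rho n : R :=
  if n is m.+1 then halpern_B rho (Rstar rho m) else 0.

Definition beta_star_tuple rho n : n.-tuple R :=
  [tuple beta_star rho i.+1 | i < n].

Definition r_lim rho : R := Num.max 0 (1 - rho^-1).

Lemma halpern_V_min rho r : 0 < rho -> 0 <= r <= 1 ->
  [/\ halpern_B rho r \in `[0, 1],
      halpern_V rho r = V_objective rho r (halpern_B rho r) &
      forall b, b \in `[0, 1] -> halpern_V rho r <= V_objective rho r b].
Proof.
move=> rho0 /andP[r0 r1].
have iv0 : 0 < rho^-1 by rewrite invr_gt0.
have ivK : rho * rho^-1 = 1 by rewrite mulfV // gt_eqF.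
have B01 : halpern_B rho r \in `[0, 1].
  by rewrite in_itv /= /halpern_B ge_min lexx le_min ler01 /= andbT; lra.
have Bmin b : b \in `[0, 1] ->
    V_objective rho r (halpern_B rho r) <= V_objective rho r b.
  rewrite in_itv /= => /andP[b0 b1]; rewrite /V_objective /halpern_B.
  set v := 2^-1 * (rho^-1 + 1 - r).
  have objE x : 1 - x + rho * x ^+ 2 + rho * x * (r - 1)
      = rho * (x - v) ^+ 2 + (1 - rho * v ^+ 2).
    have -> : 1 - x = 1 - rho * rho^-1 * x by rewrite ivK mul1r.
    by rewrite /v; field; rewrite gt_eqF.
  rewrite !objE lerD2r ler_pM2l //.
  case: (leP 1 v) => [v1|v1]; last by rewrite subrr expr0n /= sqr_ge0.
  by rewrite -subr_ge0; nra.
have lb : lbound [set V_objective rho r b | b in `[0, 1]]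
    (V_objective rho r (halpern_B rho r)).
  by move=> _ [b b01 <-]; exact: Bmin.
have VB : halpern_V rho r = V_objective rho r (halpern_B rho r).
  apply/eqP; rewrite eq_le; apply/andP; split.
    apply: ge_inf; last by exists (halpern_B rho r).
    by exists (V_objective rho r (halpern_B rho r)).
  apply: lb_le_inf => //.
  by exists (V_objective rho r (halpern_B rho r)), (halpern_B rho r).
by split=> // b b01; rewrite VB; exact: Bmin.
Qed.

End HalpernResiduals.

Arguments unit_cube {R} n _.
Arguments halpern_Rn {R} rho n b.
Arguments beta_star_tuple {R} rho n.

(* Main.v *)
(** For fixed [b], [V_objective rho r b] is nondecreasing in [r], and
    [1 - beta_n + beta_n * rho * d_n >= V_objective rho R_(n-1) beta_n], with
    equality when [beta_(n-1) <= beta_n].  Minimizing over [beta_n] and inducting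
    on [n] bounds [R_n] below by [Rstar rho n].  For [r_lim rho < r <= 1] one has
    [r_lim rho < V r < r], so [Rstar] decreases and, as [halpern_B] is
    nonincreasing in [r], [beta_star] is nondecreasing and attains the bound.  The
    limit [l] of [Rstar] satisfies [l <= V l], which forces [l = r_lim rho]. *)

Require Import Defs.
From mathcomp Require Import all_boot all_order all_algebra.
From mathcomp Require Import ring lra.
From mathcomp Require Import all_classical all_reals all_analysis.

Import Order.TTheory GRing.Theory Num.Theory.
Import numFieldNormedType.Exports.

Local Open Scope classical_set_scope.
Local Open Scope ring_scope.

Section Halpern.
Context {R : realType} {rho : R}.
Hypothesis rho_gt0 : 0 < rho.
Implicit Types (r b : R) (beta : nat -> R) (n : nat).

Lemma invrho_gt0 : 0 < rho^-1. Proof. by rewrite invr_gt0. Qed.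
Lemma mul_rhoV : rho * rho^-1 = 1. Proof. by rewrite mulfV // gt_eqF. Qed.

Lemma r_lim_ge0 : 0 <= r_lim rho.
Proof. by rewrite /r_lim le_max lexx. Qed.

Lemma r_lim_lt1 : r_lim rho < 1.
Proof. by rewrite /r_lim gt_max ltr01 /=; have := invrho_gt0; lra. Qed.

Lemma r_lim_ge : 1 - rho^-1 <= r_lim rho.
Proof. by rewrite /r_lim le_max lexx orbT. Qed.

Lemma halpern_V_eq r : 0 <= r <= 1 ->
  halpern_V rho r = V_objective rho r (halpern_B rho r).
Proof. by move=> /(halpern_V_min rho_gt0)[]. Qed.

Lemma halpern_V_le r b : 0 <= r <= 1 -> 0 <= b <= 1 ->
  halpern_V rho r <= V_objective rho r b.
Proof. by move=> /(halpern_V_min rho_gt0)[_ _ Vmin] b01; apply: Vmin. Qed.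

Lemma halpern_B_itv r : 0 <= r <= 1 -> 0 <= halpern_B rho r <= 1.
Proof. by move=> /(halpern_V_min rho_gt0)[+ _ _]; rewrite in_itv. Qed.

(** The objective equals 1 at [b = 0]. *)
Lemma halpern_V_le1 r : 0 <= r <= 1 -> halpern_V rho r <= 1.
Proof.
move=> r01; have := @halpern_V_le r 0 r01; rewrite /V_objective lexx ler01.
by move=> /(_ isT); lra.
Qed.

(** Clipped versus interior minimizer. The interior case solves for [r] in terms of [b], which turns
    the minimum into a polynomial in [b]. *)
Variant halpern_B_spec r : R -> R -> Type :=
| HalpernBOne of 1 <= 2^-1 * (rho^-1 + 1 - r) :
    halpern_B_spec r 1 (rho * r)
| HalpernBInterior b of b < 1 & r = rho^-1 + 1 - 2 * b :
    halpern_B_spec r b (1 - rho * b ^+ 2).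

Lemma halpern_BP r : 0 <= r <= 1 ->
  halpern_B_spec r (halpern_B rho r) (halpern_V rho r).
Proof.
move=> r01; rewrite halpern_V_eq // /halpern_B.
set v := 2^-1 * (rho^-1 + 1 - r).
have [v1|v1] := leP 1 v.
  by have -> : V_objective rho r 1 = rho * r;
    [rewrite /V_objective; ring | constructor].
have rE : r = rho^-1 + 1 - 2 * v by rewrite /v; field; rewrite gt_eqF.
have -> : V_objective rho r v = 1 - rho * v ^+ 2.
  by rewrite /V_objective rE; field; rewrite gt_eqF.
by constructor.
Qed.

Lemma halpern_V_itv r : r_lim rho < r <= 1 -> r_lim rho < halpern_V rho r < r.
Proof.
have rhoV_gt0 := invrho_gt0; have rhoVK := mul_rhoV.
move=> /andP[lr r1]; have r0 := le_lt_trans r_lim_ge0 lr.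
have lr' := le_lt_trans r_lim_ge lr.
have r01 : 0 <= r <= 1 by rewrite ltW.
have := halpern_B_itv r r01.
case: halpern_BP => // [v1 _|b b1 rE /andP[b0 _]].
  (* Clipping gives [rho^-1 >= 1 + r > 1], so the limit is 0 and the value [rho * r] lies strictly
     between 0 and [r]. *)
  have rhoV1 : 1 < rho^-1 by lra.
  have rho1 : rho < 1 by nra.
  rewrite /r_lim max_l; last by lra.
  by apply/andP; split; nra.
have brho : b < rho^-1 by lra.
have rb : rho * b < 1 by nra.
apply/andP; split; last first.
  (* The decrement is a perfect square, nonzero because [r > 1 - rho^-1] forces [b < rho^-1]. *)
  rewrite -subr_gt0; have -> : r - (1 - rho * b ^+ 2) = rho^-1 * (1 - rho * b) ^+ 2.
    by rewrite rE; field; rewrite gt_eqF.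
  by rewrite mulr_gt0 // exprn_gt0 // subr_gt0.
by rewrite /r_lim gt_max; apply/andP; split; nra.
Qed.

Lemma halpern_B_V r : 0 <= r <= 1 ->
  halpern_B rho (halpern_V rho r)
  = Num.min 1 ((2 * rho)^-1 * (1 + (rho * halpern_B rho r) ^+ 2)).
Proof.
have rhoV_gt0 := invrho_gt0; have rhoVK := mul_rhoV.
move=> r01; case: halpern_BP => // [v1|b b1 rE]; rewrite /halpern_B.
  (* Both minima are clipped to 1; each bound comes down to [(1 - rho)^2 >= 0]. *)
  rewrite !min_l //.
    have -> : (2 * rho)^-1 * (1 + (rho * 1) ^+ 2)
        = 1 + (2 * rho)^-1 * (1 - rho) ^+ 2 by field; rewrite gt_eqF.
    by rewrite lerDl mulr_ge0 ?sqr_ge0 // invr_ge0 mulr_ge0 // ltW.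
  by have := sqr_ge0 (1 - rho); nra.
by congr Num.min; field; rewrite gt_eqF.
Qed.

Lemma Rstar_itv n : r_lim rho < Rstar rho n <= 1.
Proof.
elim: n => [|n IHn] /=; first by rewrite r_lim_lt1 lexx.
have /andP[-> /ltW Vr] := halpern_V_itv _ IHn.
by have /andP[_ /(le_trans Vr)] := IHn.
Qed.

Lemma Rstar01 n : 0 <= Rstar rho n <= 1.
Proof.
have /andP[lR ->] := Rstar_itv n.
by rewrite andbT ltW // (le_lt_trans r_lim_ge0).
Qed.

Lemma RstarS_lt n : Rstar rho n.+1 < Rstar rho n.
Proof. by have /andP[] := halpern_V_itv _ (Rstar_itv n). Qed.

Lemma beta_starS n : beta_star rho n.+1
  = Num.min 1 ((2 * rho)^-1 * (1 + (rho * beta_star rho n) ^+ 2)).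
Proof.
(* For [n = 0], the values [R_0 = 1] and [beta_0 = 0] both lead to [min 1 (1 / (2 rho))]. *)
case: n => [|n]; last exact: (halpern_B_V _ (Rstar01 n)).
by rewrite /= /halpern_B; congr Num.min; field; rewrite gt_eqF.
Qed.

Lemma beta_star_itv n : 0 <= beta_star rho n <= 1.
Proof.
by case: n => [|n]; [rewrite lexx ler01 | exact: halpern_B_itv (Rstar01 n)].
Qed.

Lemma beta_star_le n : beta_star rho n <= beta_star rho n.+1.
Proof.
case: n => [|n]; first by have /andP[] := beta_star_itv 1.
rewrite /= /halpern_B le_min ge_min lexx /= ge_min.
by apply/orP; right; have := RstarS_lt n; rewrite /=; lra.
Qed.

(** Allows a zero-padded tuple to be exchanged for the infinite sequence [beta_star]. *)
Lemma eq_halpern_R {beta beta' : nat -> R} {n} :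
    (forall k, (k <= n)%N -> beta k = beta' k) ->
  halpern_R rho beta n = halpern_R rho beta' n.
Proof.
move=> eqb; rewrite /halpern_R /halpern_c eqb //.
suff -> : halpern_d rho beta n = halpern_d rho beta' n by [].
elim: n eqb => [//|n IHn] eqb /=.
by rewrite !eqb // IHn // => k kn; apply/eqb/leqW.
Qed.

Section UnitParameters.
Context {beta : nat -> R}.
Hypothesis beta01 : forall k, 0 <= beta k <= 1.

Lemma halpern_d_ge0 n : 0 <= halpern_d rho beta n.
Proof.
elim: n => //= n IHn; rewrite addr_ge0 // mulr_ge0 // le_min ?ler01 /=.
  by have /andP[-> _] := beta01 n; have /andP[-> _] := beta01 n.+1.
by rewrite mulr_ge0 // ltW.
Qed.

Lemma halpern_c01 n : 0 <= halpern_c rho beta n <= 1.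
Proof.
rewrite /halpern_c le_min ler01 ge_min lexx andbT /=.
by rewrite mulr_ge0 ?halpern_d_ge0 // ltW.
Qed.

(** Write [a], [b], [c] for [beta n], [beta n.+1], [halpern_c rho beta n]. The left side is
    [b - a + a c]: equality holds if [a <= b], and otherwise the gap is [(a - b)(2 - c) >= 0]. *)
Lemma halpern_d_ge n :
  beta n.+1 - 1 + halpern_R rho beta n <= halpern_d rho beta n.+1.
Proof.
rewrite /halpern_R /= -/(halpern_c rho beta n).
have /andP[c0 c1] := halpern_c01 n; have /andP[b0 b1] := beta01 n.
by have [bb|bb] := leP (beta n) (beta n.+1);
  [rewrite distrC ger0_norm ?subr_ge0 //; lra
  |rewrite gtr0_norm ?subr_gt0 //; nra].
Qed.

Lemma halpern_d_nondecreasing n : beta n <= beta n.+1 ->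
  halpern_d rho beta n.+1 = beta n.+1 - 1 + halpern_R rho beta n.
Proof.
move=> bb; rewrite /halpern_R /= -/(halpern_c rho beta n) min_l //.
by rewrite distrC ger0_norm ?subr_ge0 //; ring.
Qed.

Lemma Rstar_le_halpern_R n : beta 0 = 0 ->
  Rstar rho n <= halpern_R rho beta n.
Proof.
move=> beta0; elim: n => [|n IHn]; first by rewrite /halpern_R beta0 /=; lra.
have r01 := Rstar01 n; have /andP[b0 b1] := beta01 n.+1.
rewrite [Rstar _ _]/= /halpern_R /halpern_c.
(* If the cap in [halpern_c] is active, the residual bound is 1, which dominates every value of
   [halpern_V] on [[0, 1]]. *)
have [_|_] := leP 1 (rho * halpern_d rho beta n.+1).
  by rewrite subrr mulr0 subr0 halpern_V_le1.
apply: le_trans (halpern_V_le _ (beta n.+1) r01 (beta01 _)) _.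
have dge : beta n.+1 - 1 + Rstar rho n <= halpern_d rho beta n.+1.
  by apply: le_trans (halpern_d_ge n); rewrite lerD2l.
have := ler_wpM2l (mulr_ge0 b0 (ltW rho_gt0)) dge.
by rewrite /V_objective; lra.
Qed.

End UnitParameters.

Lemma halpern_R_beta_star n : halpern_R rho (beta_star rho) n = Rstar rho n.
Proof.
elim: n => [|n IHn]; first by rewrite /halpern_R /=; lra.
rewrite /halpern_R /halpern_c halpern_d_nondecreasing ?beta_star_le // IHn.
have rhoV_gt0 := invrho_gt0; have rhoVK := mul_rhoV.
(* The cap in [halpern_c] is inactive: [b <= (rho^-1 + 1 - r) / 2] gives [rho (b - 1 + r) <= (1 -
   rho (1 - r)) / 2 <= 1/2]. *)
have r01 := Rstar01 n; rewrite min_r /=; last first.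
  have : halpern_B rho (Rstar rho n) <= 2^-1 * (rho^-1 + 1 - Rstar rho n).
    by rewrite ge_min lexx orbT.
  by move: r01 => /andP[r0 r1]; nra.
by rewrite halpern_V_eq // /V_objective; ring.
Qed.

Lemma Rstar_decreasing : decreasing_seq (Rstar rho).
Proof. by apply/decreasing_seqP => n; exact: RstarS_lt. Qed.

Lemma Rstar_cvg : Rstar rho n @[n --> \oo] --> r_lim rho.
Proof.
have lbR n : r_lim rho <= Rstar rho n by have /andP[/ltW] := Rstar_itv n.
have cR : cvgn (Rstar rho).
  apply: nonincreasing_is_cvgn.
    by apply/nonincreasing_seqP => n; exact/ltW/RstarS_lt.
  by exists (r_lim rho) => _ [n _ <-].
set l := limn (Rstar rho); have Rl : Rstar rho n @[n --> \oo] --> l by [].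
have ll : r_lim rho <= l by apply: limr_ge => //; apply: nearW.
have l1 : l <= 1.
  by apply: limr_le => //; apply: nearW => n; have /andP[] := Rstar_itv n.
have l01 : 0 <= l <= 1 by rewrite (le_trans r_lim_ge0).
have lV : l <= halpern_V rho l.
  (* The minimizer at the limit [l] is kept fixed for all [n]: [Rstar rho n.+1] is at most the
     objective at [Rstar rho n] and [b], which is affine in [Rstar rho n], so the inequality passes
     to the limit. *)
  rewrite halpern_V_eq //; set b := halpern_B rho l.
  have RS : Rstar rho n.+1 @[n --> \oo] --> l by rewrite (cvg_shiftS (Rstar rho)).
  have RV : V_objective rho (Rstar rho n) b @[n --> \oo] --> V_objective rho l b.
    rewrite /V_objective; apply: cvgD; first exact: cvg_cst.
    by apply: cvgMr; apply: cvgB => //; exact: cvg_cst.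
  apply: (ler_cvg_to RS RV); apply: nearW => n.
  exact: halpern_V_le (Rstar01 n) (halpern_B_itv _ l01).
suff -> : r_lim rho = l by [].
apply/eqP; rewrite eq_le ll leNgt; apply/negP => lt_l.
have /andP[_] : r_lim rho < halpern_V rho l < l.
  by apply: halpern_V_itv; rewrite lt_l.
by rewrite ltNge lV.
Qed.

End Halpern.

Theorem proposition2 (R : realType) (rho : R) (rho_gt0 : 0 < rho) :
  [/\ forall n : nat,
        beta_star rho n.+1
        = Num.min 1 ((2 * rho)^-1 * (1 + (rho * beta_star rho n) ^+ 2)),
      forall n : nat, (1 <= n)%N ->
        [/\ unit_cube n (beta_star_tuple rho n),
            halpern_Rn rho n (beta_star_tuple rho n) = Rstar rho n &
            forall b : n.-tuple R, unit_cube n b ->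
              Rstar rho n <= halpern_Rn rho n b] &
      [/\ decreasing_seq (Rstar rho),
          Rstar rho n @[n --> \oo] --> r_lim rho &
          r_lim rho \in `[0, 1[]].
Proof.
split; first exact: beta_starS.
  move=> n _; split.
  - by move=> i; rewrite tnth_mktuple in_itv; exact: beta_star_itv.
  - rewrite -halpern_R_beta_star // /halpern_Rn; apply: eq_halpern_R => -[//|k] kn.
    by have /= <- := tnth_nth 0 (beta_star_tuple rho n) (Ordinal kn);
      rewrite tnth_mktuple.
  - move=> b b01; apply: Rstar_le_halpern_R => // -[|k] /=.
      by rewrite lexx ler01.
    have [kn|nk] := ltnP k n.
      by have := b01 (Ordinal kn); rewrite in_itv /= (tnth_nth 0).
    (* Beyond index [n] the default value 0 is read, which also lies in [[0, 1]]. *)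
    by rewrite nth_default ?size_tuple // lexx ler01.
split; [exact: Rstar_decreasing | exact: Rstar_cvg |].
by rewrite in_itv /= r_lim_ge0 r_lim_lt1.
Qed.
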